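(* Let $G$ and $H$ be two cers. If $G$ and $H$ are resonantly equivalent, then the resonance graph $R(G)$ is isomorphic to the resonance graph $R(H)$.
   Context: An even ring system is a simple bipartite 2-connected plane graph in which all interior vertices have degree 3 and all boundary vertices have degree 2 or 3. The inner dual has a vertex for each inner face, two vertices adjacent iff the faces share an edge. A cers (catacondensed even ring system) is an even ring system whose inner dual is a tree. The resonance graph $R(G)$ of a cers $G$ has as vertices the perfect matchings of $G$, two perfect matchings $M_1,M_2$ being adjacent iff their symmetric difference $M_1\oplus M_2$ is exactly the edge set of one inner face of $G$. If $F$ is an inner face and $F_0$ the outer face of $G$, a connected component of the subgraph induced by $E(F)\cap E(F_0)$ is called a boundary segment. Transformation 1: given a cers $G$ and a boundary segment $P$, obtain a cers $G'$ by subdividing edges of $P$ an even number of times in total, or conversely by smoothing an even number of (degree-2) vertices of $P$. Two cers $G,H$ are resonantly equivalent if $G$ can be obtained from $H$ by successively applying Transformation 1. *)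

(* Defs.v *)
(* Plane graphs are encoded combinatorially, as rotation systems of
   genus 0 with a distinguished outer face. *)
From mathcomp Require Import all_boot.
From Stdlib Require Export Relation_Operators.

Set Implicit Arguments.
Unset Strict Implicit.
Unset Printing Implicit Defensive.

Record sgraph := SGraph {
  vertex :> finType;
  adj : rel vertex;
  adj_sym : symmetric adj;
  adj_irr : irreflexive adj }.

Section SimpleGraphs.
Variable G : sgraph.

Definition edges : {set {set G}} :=
  [set [set p.1; p.2] | p : G * G & adj p.1 p.2].

Definition degree (x : G) : nat := #|[set y | adj x y]|.

Definition connected : Prop := forall x y : G, connect (@adj G) x y.

Definition two_connected : Prop :=
  [/\ 2 < #|G|, connected &
      forall x y z : G, y != x -> z != x ->
        connect [rel a b | [&& adj a b, a != x & b != x]] y z].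

Definition bipartite : Prop :=
  exists c : G -> bool, forall x y : G, adj x y -> c x != c y.

Definition is_tree : Prop :=
  [/\ 0 < #|G|, connected &
      forall s : seq G, ucycle (@adj G) s -> size s <= 2].

Definition perfect_matching (M : {set {set G}}) : bool :=
  (M \subset edges) && [forall x : G, #|[set e in M | x \in e]| == 1].

End SimpleGraphs.

Definition isomorphic (G H : sgraph) : Prop :=
  exists2 f : G -> H, bijective f & forall x y : G, adj (f x) (f y) = adj x y.

(* [rot v] is the cyclic order of the neighbours of [v]: each neighbour of [v]
   is reached from any other by iterating [rot v]. Its values off the
   neighbourhood of [v] are irrelevant. A dart is a pair [(x, y)] with
   [adj x y]; [outer_dart] is any dart of the outer face. *)
Record embedded_graph := EmbeddedGraph {
  skeleton :> sgraph;
  rot : skeleton -> skeleton -> skeleton;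
  rot_adj : forall v x, adj v x -> adj v (rot v x);
  rot_cyclic : forall v x y, adj v x -> adj v y -> fconnect (rot v) x y;
  outer_dart : skeleton * skeleton;
  outer_dart_adj : adj outer_dart.1 outer_dart.2 }.

Section Faces.
Variable G : embedded_graph.

Definition next_dart (d : G * G) : G * G := (d.2, rot d.2 d.1).

Definition face_of (d : G * G) : {set G * G} :=
  [set d' | fconnect next_dart d d'].

Definition faces : {set {set G * G}} :=
  [set face_of d | d : G * G & adj d.1 d.2].

Definition outer_face : {set G * G} := face_of (outer_dart G).

Definition inner_faces : {set {set G * G}} := faces :\ outer_face.

Definition face_edges (F : {set G * G}) : {set {set G}} :=
  [set [set d.1; d.2] | d in F].

(* Euler's formula says that a connected rotation system has genus 0. *)
Definition plane : Prop :=
  connected G /\ #|G| + #|faces| = #|edges G| + 2.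

Definition boundary_vertex (x : G) : bool := [exists d in outer_face, d.1 == x].

Definition even_ring_system : Prop :=
  [/\ plane, bipartite G, two_connected G,
      forall x : G, ~~ boundary_vertex x -> degree x = 3 &
      forall x : G, boundary_vertex x -> degree x = 2 \/ degree x = 3].

Definition inner_face : finType := {F : {set G * G} | F \in inner_faces}.

Definition inner_dual_adj : rel inner_face :=
  [rel F1 F2 | (F1 != F2) &&
     (face_edges (val F1) :&: face_edges (val F2) != set0)].

Lemma inner_dual_sym : symmetric inner_dual_adj.
Proof. by move=> F1 F2; rewrite /inner_dual_adj /= eq_sym setIC. Qed.

Lemma inner_dual_irr : irreflexive inner_dual_adj.
Proof. by move=> F; rewrite /inner_dual_adj /= eqxx. Qed.

Definition inner_dual : sgraph := SGraph inner_dual_sym inner_dual_irr.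

Definition cers : Prop := even_ring_system /\ is_tree inner_dual.

Definition pmatching : finType := {M : {set {set G}} | perfect_matching M}.

Definition symdiff (A B : {set {set G}}) : {set {set G}} :=
  (A :\: B) :|: (B :\: A).

Definition resonance_adj : rel pmatching :=
  [rel M1 M2 | [exists F in inner_faces,
     symdiff (val M1) (val M2) == face_edges F]].

Lemma resonance_sym : symmetric resonance_adj.
Proof. by move=> M1 M2; apply: eq_existsb => F; rewrite /symdiff setUC. Qed.

Lemma resonance_irr : irreflexive resonance_adj.
Proof.
move=> M; apply/existsP => -[F /andP[]].
rewrite inE => /andP[_ /imsetP[d _ ->]].
rewrite /symdiff setDv setUid eq_sym => /eqP /setP /(_ [set d.1; d.2]).
rewrite in_set0 => /negP; apply; apply/imsetP.
by exists d; rewrite // inE connect0.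
Qed.

Definition resonance_graph : sgraph := SGraph resonance_sym resonance_irr.

(* Edge set of the component containing [x] of the graph with edge set [S]. *)
Definition edge_component (S : {set {set G}}) (x : G) : {set {set G}} :=
  [set e in S | [exists y in e, connect [rel a b | [set a; b] \in S] x y]].

Definition boundary_segment (P : {set {set G}}) : Prop :=
  exists2 F, F \in inner_faces &
    let S := face_edges F :&: face_edges outer_face in
    exists2 x, x \in cover S & P = edge_component S x.

End Faces.

(* The edge [uv] is replaced by the path [Some u, None, Some v]. *)
Section Subdivision.
Variables (G : embedded_graph) (u v : G) (uv : adj u v).

Definition sub_adj : rel (option G) := fun a b =>
  match a, b with
  | Some x, Some y => adj x y && ([set x; y] != [set u; v])
  | Some x, None | None, Some x => x \in [set u; v]
  | None, None => false
  end.

Lemma sub_adj_sym : symmetric sub_adj.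
Proof. by move=> [x|] [y|] //=; rewrite adj_sym setUC. Qed.

Lemma sub_adj_irr : irreflexive sub_adj.
Proof. by move=> [x|] //=; rewrite adj_irr. Qed.

Definition sub_sgraph : sgraph := SGraph sub_adj_sym sub_adj_irr.

(* [sub_head x y] is the head of the dart that [(x, y)] becomes at [Some x];
   [sub_unhead x] inverts it on the neighbours of [x]. *)
Definition sub_head (x y : G) : option G :=
  if [set x; y] == [set u; v] then None else Some y.

Definition sub_unhead (x : G) (a : option G) : G :=
  if a is Some y then y else if x == u then v else u.

Definition sub_rot (a b : option G) : option G :=
  if a is Some x then sub_head x (rot x (sub_unhead x b))
  else if b == Some u then Some v else Some u.

Lemma sub_neq : u != v.
Proof. by apply: contraTneq uv => ->; rewrite adj_irr. Qed.

Lemma sub_edgeP x y :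
  reflect ((x = u /\ y = v) \/ (x = v /\ y = u)) ([set x; y] == [set u; v]).
Proof.
apply: (iffP eqP) => [E|[[-> ->]|[-> ->]] //]; last by rewrite setUC.
have: x \in [set u; v] by rewrite -E set21.
have: y \in [set u; v] by rewrite -E set22.
have: u \in [set x; y] by rewrite E set21.
have: v \in [set x; y] by rewrite E set22.
rewrite !in_set2 => /orP[]/eqP ? /orP[]/eqP ? /orP[]/eqP ? /orP[]/eqP ?;
  subst; by [left | right | move: sub_neq; rewrite eqxx].
Qed.

Lemma sub_headK x y : sub_unhead x (sub_head x y) = y.
Proof.
rewrite /sub_head; case: sub_edgeP => [[[-> ->]|[-> ->]]|//] /=.
  by rewrite eqxx.
by rewrite eq_sym (negbTE sub_neq).
Qed.

Lemma sub_head_adj x y : adj x y -> sub_adj (Some x) (sub_head x y).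
Proof.
move=> xy; rewrite /sub_head; case: ifP => [|/= ->]; last by rewrite xy.
by case/sub_edgeP => -[-> _]; rewrite /= in_set2 eqxx ?orbT.
Qed.

Lemma sub_adj_head x a : sub_adj (Some x) a ->
  exists2 y, adj x y & a = sub_head x y.
Proof.
case: a => [y /andP[xy ne]|]; first by exists y; rewrite // /sub_head (negbTE ne).
rewrite /= in_set2 => /orP[]/eqP->; [exists v | exists u] => //.
- by rewrite /sub_head eqxx.
- by rewrite adj_sym.
- by rewrite /sub_head setUC eqxx.
Qed.

Lemma sub_rot_adj a b : sub_adj a b -> sub_adj a (sub_rot a b).
Proof.
case: a => [x /sub_adj_head[y xy ->]|_]; last first.
  by rewrite /sub_rot; case: ifP; rewrite /= in_set2 eqxx ?orbT.
by rewrite [sub_rot _ _]/= sub_headK; apply/sub_head_adj/rot_adj.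
Qed.

Lemma sub_rot_cyclic a b c :
  sub_adj a b -> sub_adj a c -> fconnect (sub_rot a) b c.
Proof.
case: a => [x /sub_adj_head[y xy ->] /sub_adj_head[z xz ->]|]; last first.
  case: b c => [b|//] [c|//]; rewrite /= !in_set2.
  move=> /orP[]/eqP-> /orP[]/eqP->; rewrite ?connect0 // connect1 //=.
    by rewrite eqxx.
  by rewrite (inj_eq Some_inj) [v == u]eq_sym (negbTE sub_neq).
have /iter_findex <- := rot_cyclic xy xz.
elim: (findex _ _ _) => [|n IHn]; first exact: connect0.
apply: connect_trans IHn _; apply: connect1.
by rewrite /= sub_headK.
Qed.

Definition sub_outer : sub_sgraph * sub_sgraph :=
  (Some (outer_dart G).1, sub_head (outer_dart G).1 (outer_dart G).2).

Lemma sub_outer_adj : adj sub_outer.1 sub_outer.2.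
Proof. exact: sub_head_adj (outer_dart_adj G). Qed.

Definition subdivide : embedded_graph :=
  @EmbeddedGraph sub_sgraph sub_rot sub_rot_adj sub_rot_cyclic
    sub_outer sub_outer_adj.

(* The set of edges that [P] becomes when its edge [uv] is subdivided. *)
Definition sub_segment (P : {set {set G}}) : {set {set subdivide}} :=
  [set (@Some G) @: (e : {set G}) | e in P :\ [set u; v]]
    :|: [set [set Some u; None]; [set None; Some v]].

End Subdivision.

(* Combinatorial form of "some homeomorphism of the plane carries [G] to [H]";
   the two alternatives preserve, respectively reverse, the orientation. *)
Definition plane_isomorphic (G H : embedded_graph) : Prop :=
  exists f : G -> H,
  [/\ bijective f,
      forall x y : G, adj (f x) (f y) = adj x y &
      ((forall x y : G, adj x y -> rot (f x) (f y) = f (rot x y)) /\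
       (f (outer_dart G).1, f (outer_dart G).2) \in outer_face H)
   \/ ((forall x y : G, adj x y -> rot (f x) (f (rot x y)) = f y) /\
       (f (outer_dart G).2, f (outer_dart G).1) \in outer_face H)].

(* [subdivided P n H]: up to plane isomorphism, [H] arises from [G] by [n]
   successive subdivisions of edges of [P] (the pieces of a subdivided edge
   replacing it in [P]). *)
Inductive subdivided (G : embedded_graph) (P : {set {set G}}) :
    nat -> embedded_graph -> Prop :=
| Subdivided0 H : plane_isomorphic G H -> subdivided P 0 H
| SubdividedS n H (u v : G) (uv : adj u v) :
    [set u; v] \in P -> subdivided (sub_segment uv P) n H ->
    subdivided P n.+1 H.

Definition segment_subdivision (G H : embedded_graph) : Prop :=
  exists P : {set {set G}}, exists n : nat,
    [/\ boundary_segment P, ~~ odd n & subdivided P n H].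

(* Smoothing vertices of a boundary segment is the converse of subdividing
   edges of the resulting segment. *)
Definition transformation1 (G G' : embedded_graph) : Prop :=
  [/\ cers G, cers G' & segment_subdivision G G' \/ segment_subdivision G' G].

Definition resonantly_equivalent (G H : embedded_graph) : Prop :=
  clos_refl_trans embedded_graph transformation1 H G.

(* Main.v *)
Require Import Defs.
From mathcomp Require Import all_boot all_algebra.

Set Implicit Arguments.
Unset Strict Implicit.
Unset Printing Implicit Defensive.

(** Call a set [M] of edges a [D]-twisted matching if it covers each vertex
    outside [D] exactly once and each vertex of [D] an even number of times.
    Subdividing an edge and adding the new vertex to [D] does not change the
    twisted matchings, nor the face boundaries by which two of them may differ.
    After an even number of subdivisions of a segment [P], the set [D] is an
    even set of vertices, of degree 2 and interior to [P]. As [P] is connected it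
    contains a set [Q] of edges with odd degree exactly on [D], and toggling [Q]
    turns twisted matchings into perfect matchings without changing symmetric
    differences.

    That a vertex on two edges of a boundary segment has degree 2 is where
    planarity enters: otherwise its third edge would have the same face on both
    sides, which Euler's formula excludes by a rank count over [F_2]. *)

(** * Unordered pairs and reachability *)

Lemma set2_injr (T : finType) (x y z : T) : [set x; y] = [set x; z] -> y = z.
Proof.
move=> E; have: y \in [set x; z] by rewrite -E set22.
rewrite in_set2 => /orP[]/eqP // yx; have: z \in [set x; y] by rewrite E set22.
by rewrite in_set2 yx orbb => /eqP.
Qed.

Lemma eq_set2P (T : finType) (a b c d : T) : [set a; b] = [set c; d] ->
  (a, b) = (c, d) \/ (a, b) = (d, c).
Proof.
move=> E; have: a \in [set c; d] by rewrite -E set21.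
rewrite in_set2 => /orP[]/eqP Ea; subst a; first by left; rewrite (set2_injr E).
by right; rewrite setUC [RHS]setUC in E; rewrite (@set2_injr _ d b c) // setUC E setUC.
Qed.

Lemma connect_homo (T U : finType) (e : rel T) (e' : rel U) (f : T -> U) :
    (forall x y, e x y -> connect e' (f x) (f y)) ->
  forall x y, connect e x y -> connect e' (f x) (f y).
Proof.
move=> h x y /connectP[p]; elim: p x => [|z p IHp] x /=; first by move=> _ ->.
by case/andP=> /h xz zp Ey; apply: connect_trans xz (IHp _ zp Ey).
Qed.

Lemma connect_constant (T : finType) (U : Type) (e : rel T) (c : T -> U) :
    (forall x y, e x y -> c x = c y) ->
  forall x y, connect e x y -> c x = c y.
Proof.
move=> h x y /connectP[p]; elim: p x => [|z p IHp] x /=; first by move=> _ ->.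
by case/andP=> /h-> zp Ey; apply: IHp.
Qed.

(** * Edge sets, degrees inside them, and twisted matchings *)

Section Incidence.
Variable G : sgraph.
Implicit Types (M N : {set {set G}}) (x y : G).

Lemma edgesP e :
  reflect (exists x y : G, adj x y /\ e = [set x; y]) (e \in edges G).
Proof.
apply: (iffP imsetP) => [[p]|[x [y [xy ->]]]]; last by exists (x, y); rewrite ?inE.
by rewrite inE => p12 ->; exists p.1, p.2.
Qed.

Lemma mem_edges x y : ([set x; y] \in edges G) = adj x y.
Proof.
apply/edgesP/idP => [[a [b [ab /eq_set2P[][-> ->]]]]|xy] //; first by rewrite adj_sym.
by exists x, y.
Qed.

Definition mdeg M x := #|[set y | adj x y & [set x; y] \in M]|.

Lemma degree_mdeg x : degree x = mdeg (edges G) x.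
Proof. by apply: eq_card => y; rewrite !inE mem_edges andbb. Qed.

Lemma mdeg_le_degree M x : mdeg M x <= degree x.
Proof. by apply/subset_leq_card/subsetP => y; rewrite !inE => /andP[]. Qed.

Lemma leq_mdeg M N x : M \subset N -> mdeg M x <= mdeg N x.
Proof.
move/subsetP=> MN; apply/subset_leq_card/subsetP => y; rewrite !inE.
by case/andP=> -> /MN.
Qed.

Lemma mdeg_gt0 M x y : adj x y -> [set x; y] \in M -> 0 < mdeg M x.
Proof. by move=> xy xyM; apply/card_gt0P; exists y; rewrite inE xy. Qed.

Lemma card_edges_at M x :
  M \subset edges G -> #|[set e in M | x \in e]| = mdeg M x.
Proof.
move/subsetP=> ME; rewrite /mdeg.
have /card_imset <-: injective (fun y => [set x; y]) by move=> y z /set2_injr.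
apply: eq_card => e; apply/idP/imsetP => [|[y]]; rewrite !inE; last first.
  by case/andP=> _ yM ->; rewrite yM set21.
case/andP=> eM; have /edgesP[a [b [ab Ee]]] := ME _ eM; rewrite {}Ee in eM *.
rewrite in_set2 => /orP[]/eqP->; first by exists b; rewrite // inE ab.
by exists a; rewrite ?inE setUC // adj_sym ab.
Qed.

(** The form in which degree parity is additive under symmetric difference. *)
Lemma odd_mdeg M x :
  odd (mdeg M x) = \big[addb/false]_(y | adj x y) ([set x; y] \in M).
Proof.
rewrite /mdeg -sum1_card (eq_bigl (fun y => adj x y && ([set x; y] \in M))).
  rewrite (big_morph odd oddD (erefl _)) big_mkcondr /=.
  by apply: eq_bigr => y _; case: ifP.
by move=> y; rewrite inE.
Qed.

(* With [D] empty these are the perfect matchings; on [D] the parity is reversed. *)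
Definition twisted_matching (D : {set G}) M :=
  (M \subset edges G) &&
  [forall x, if x \in D then ~~ odd (mdeg M x) else mdeg M x == 1].

Lemma perfect_matchingE M : perfect_matching M = twisted_matching set0 M.
Proof.
apply: andb_id2l => ME; apply: eq_forallb => x.
by rewrite in_set0 card_edges_at.
Qed.

End Incidence.

(** * Symmetric differences and T-joins *)

Section Symdiff.
Variable G : embedded_graph.
Implicit Types (A B C : {set {set G}}) (x : G).

Lemma in_symdiff A B e : (e \in symdiff A B) = (e \in A) (+) (e \in B).
Proof. by rewrite !inE; case: (e \in A); case: (e \in B). Qed.

Lemma symdiffK B : involutive ((@symdiff G)^~ B).
Proof. by move=> A; apply/setP=> e; rewrite !in_symdiff -addbA addbb addbF. Qed.

Lemma symdiff_cancel A B C : symdiff (symdiff A C) (symdiff B C) = symdiff A B.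
Proof.
by apply/setP=> e; rewrite !in_symdiff addbACA addbb addbF.
Qed.

Lemma symdiff_subset A B C :
  A \subset C -> B \subset C -> symdiff A B \subset C.
Proof.
move=> /subsetP AC /subsetP BC; apply/subsetP=> e; rewrite in_symdiff.
by case: (boolP (e \in A)) => [/AC //|_]; case: (boolP (e \in B)) => [/BC|].
Qed.

Lemma odd_mdeg_symdiff A B x :
  odd (mdeg (symdiff A B) x) = odd (mdeg A x) (+) odd (mdeg B x).
Proof.
by rewrite !odd_mdeg -big_split; apply: eq_bigr => y _; rewrite in_symdiff.
Qed.

Lemma odd_mdeg_edge (a b x : G) :
  adj a b -> odd (mdeg [set [set a; b]] x) = (x == a) (+) (x == b).
Proof.
move=> ab; have nab: a != b by apply: contraTneq ab => ->; rewrite adj_irr.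
case: (altP (x =P a)) => [->|xa].
  rewrite (negbTE nab) (_ : mdeg _ _ = 1) //; apply/eqP/cards1P; exists b.
  by apply/setP=> y; rewrite !inE; apply/andP/eqP => [[_ /eqP/set2_injr]|->].
case: (altP (x =P b)) => [->|xb].
  rewrite (_ : mdeg _ _ = 1) //; apply/eqP/cards1P; exists a.
  apply/setP=> y; rewrite !inE [[set a; b]]setUC adj_sym.
  apply/andP/eqP => [[_ /eqP/set2_injr]|->] //.
rewrite (_ : mdeg _ _ = 0) //; apply/eqP; rewrite cards_eq0; apply/eqP/setP=> y.
rewrite !inE; apply/andP => -[_ /eqP/eq_set2P[][/eqP]]; first by rewrite (negbTE xa).
by rewrite (negbTE xb).
Qed.

(* The T-join lemma, with the parity defect of [s] pushed to the root [r]. *)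
Lemma exists_tjoin (P : {set {set G}}) (r : G) (s : seq G) :
    P \subset edges G ->
    {in s, forall x, connect [rel a b | [set a; b] \in P] x r} ->
  exists2 Q : {set {set G}}, Q \subset P &
    forall x, odd (mdeg Q x)
            = odd (count_mem x s) (+) (odd (size s) && (x == r)).
Proof.
(* For a single source [a], the edges of a walk from [a] to [r] are toggled one by one; repeated
   edges cancel, so the walk need not be simple. *)
move=> PE; have path_join a: connect [rel a b | [set a; b] \in P] a r ->
    exists2 Q : {set {set G}}, Q \subset P & forall x, odd (mdeg Q x) = (x == a) (+) (x == r).
  case/connectP=> p; elim: p a => [|b p IHp] a /=.
    move=> _ ->; exists set0; rewrite ?sub0set // => x; rewrite addbb.
    by rewrite odd_mdeg big1 // => y _; rewrite in_set0.
  case/andP=> abP bp Er; have [Q QP Qodd] := IHp b bp Er.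
  exists (symdiff [set [set a; b]] Q).
    by rewrite symdiff_subset // sub1set.
  move=> x; rewrite odd_mdeg_symdiff Qodd odd_mdeg_edge.
    by case: (x == a); case: (x == b); case: (x == r).
  by rewrite -mem_edges (subsetP PE).
elim: s => [|a s IHs] sr.
  exists set0; rewrite ?sub0set // => x.
  by rewrite odd_mdeg big1 // => y _; rewrite in_set0.
have [|Q QP Qodd] := IHs; first by move=> x xs; apply: sr; rewrite inE xs orbT.
have [|Q' QP' Qodd'] := path_join a; first by apply: sr; rewrite mem_head.
exists (symdiff Q' Q); first exact: symdiff_subset.
move=> x; rewrite odd_mdeg_symdiff Qodd Qodd' /= oddD eq_sym.
by case: (a == x); case: (x == r); case: (odd _); case: (odd _).
Qed.

End Symdiff.

(** * Darts and faces of a rotation system *)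

Section Darts.
Variable G : embedded_graph.
Implicit Types (d : G * G) (v x y : G).

Definition dart : {pred G * G} := fun d => adj d.1 d.2.

Lemma next_dart_dart d : d \in dart -> next_dart d \in dart.
Proof. by move=> dd; apply: rot_adj; rewrite adj_sym. Qed.

(** Cyclicity leads from [rot v x] back to [x], so [rot v] maps the neighbours of [v] onto
    themselves; on a finite set a surjection is injective. *)
Lemma rot_in_inj v : {in adj v &, injective (@Defs.rot G v)}.
Proof.
apply/imset_injP; rewrite eqn_leq leq_imset_card subset_leq_card //.
apply/subsetP=> x vx.
have /iter_findex <- := rot_cyclic (rot_adj vx) vx.
rewrite -iterSr iterS; apply: imset_f.
by elim: (findex _ _ _) => [|n IHn] //=; apply: rot_adj.
Qed.

Lemma next_dart_inj : {in dart &, injective (@next_dart G)}.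
Proof.
move=> [a b] [c d] ab cd [E]; rewrite {}E in ab *.
by move/rot_in_inj=> -> //; [move: ab | move: cd]; rewrite !unfold_in /= adj_sym.
Qed.

Lemma face_connect_sym d d' : d \in dart -> d' \in dart ->
  fconnect (@next_dart G) d d' = fconnect (@next_dart G) d' d.
Proof. exact: (fconnect_sym_in next_dart_dart next_dart_inj). Qed.

Lemma in_face_of d d' : (d' \in face_of d) = fconnect (@next_dart G) d d'.
Proof. by rewrite inE. Qed.

Lemma face_of_dart d d' : d \in dart -> d' \in face_of d -> d' \in dart.
Proof.
rewrite in_face_of => dd /iter_findex <-.
by elim: (findex _ _ _) => [|n IHn] //=; apply: next_dart_dart.
Qed.

Lemma face_of_refl d : d \in face_of d.
Proof. by rewrite inE connect0. Qed.

Lemma face_of_eq d d' : d \in dart -> d' \in face_of d -> face_of d' = face_of d.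
Proof.
move=> dd d'd; have dd' := face_of_dart dd d'd; rewrite in_face_of in d'd.
have d'd2: fconnect (@next_dart G) d' d by rewrite face_connect_sym.
by apply/setP=> c; rewrite !in_face_of; apply/idP/idP; apply: connect_trans.
Qed.

Lemma face_of_next d : d \in dart -> face_of (next_dart d) = face_of d.
Proof. by move=> dd; apply: face_of_eq; rewrite // in_face_of fconnect1. Qed.

Lemma outer_dart_dart : outer_dart G \in dart.
Proof. exact: outer_dart_adj. Qed.

Lemma facesP F : reflect (exists2 d, d \in dart & F = face_of d) (F \in faces G).
Proof.
apply: (iffP imsetP) => [[d]|[d dd ->]]; last by exists d; rewrite // inE.
by rewrite inE => dd ->; exists d.
Qed.

Lemma mem_face F d : F \in faces G -> d \in F -> F = face_of d.
Proof. by case/facesP=> d0 dd0 -> dF; rewrite (face_of_eq dd0). Qed.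

Lemma face_edgesP (F : {set G * G}) e :
  reflect (exists2 d, d \in F & e = [set d.1; d.2]) (e \in face_edges F).
Proof. exact: imsetP. Qed.

Lemma face_edges_sub d : d \in dart -> face_edges (face_of d) \subset edges G.
Proof.
move=> dd; apply/subsetP=> e /face_edgesP[d' d'd ->].
by rewrite mem_edges; apply: face_of_dart d'd.
Qed.

End Darts.

(** * The two sides of an edge: incidence matrices over [F_2] *)

Section TwoSidedEdges.
Import GRing.Theory.
Local Open Scope ring_scope.
Variable G : embedded_graph.
Implicit Types (d : G * G) (F : {set G * G}) (e : {set G}).

Let K := 'F_2.

Let F2_eq (a b : K) : a + b = 0 -> a = b.
Proof.
move/eqP; rewrite addr_eq0 => /eqP->; apply: oppr_pchar2.
exact: pchar_Fp.
Qed.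

(** The hypothesis confines the left kernel, of dimension [m - \rank A], to a line. *)
Lemma rank_ker_le1 m n (A : 'M[K]_(m, n)) (w : 'rV_m) :
    (forall r : 'rV_m, r *m A = 0 -> (r <= w)%MS) -> (m <= (\rank A).+1)%N.
Proof.
move=> kerA; rewrite -addn1 -leq_subLR -mxrank_ker.
apply: leq_trans (rank_leq_row w); apply/mxrankS/rV_subP=> r /sub_kermxP.
exact: kerA.
Qed.

Let edge d : {set G} := [set d.1; d.2].

(** The face-edge incidence matrix. Entries count darts, so an edge with one face on both sides
    contributes 2, that is 0. *)
Let B : 'M[K]_(#|faces G|, #|edges G|) :=
  \matrix_(i, j) \sum_(d in (enum_val i : {set G * G})) (edge d == enum_val j)%:R.

(** The edge-vertex incidence matrix, bordered by the indicator column of [e0]. *)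
Let A (e0 : {set G}) : 'M[K]_(#|edges G|, #|G| + 1) :=
  row_mx (\matrix_(j, k) (enum_val k \in (enum_val j : {set G}))%:R)
         (\col_j (enum_val j == e0)%:R).

Lemma face_sum_edges F (h : {set G} -> K) : F \in faces G ->
  \sum_(e in edges G) (\sum_(d in F) (edge d == e)%:R) * h e
  = \sum_(d in F) h (edge d).
Proof.
case/facesP=> d0 dd0 ->; under eq_bigr do rewrite mulr_suml.
rewrite exchange_big; apply: eq_bigr => d dF.
have dE: edge d \in edges G by rewrite mem_edges; apply: face_of_dart dF.
rewrite (bigD1 (edge d)) //= eqxx mul1r big1 ?addr0 // => e /andP[_].
by rewrite eq_sym => /negbTE->; rewrite mul0r.
Qed.

(** The head of a dart is the tail of its successor, and [next_dart] permutes the face. *)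
Lemma face_sum_next F (h : G -> K) : F \in faces G ->
  \sum_(d in F) h d.2 = \sum_(d in F) h d.1.
Proof.
case/facesP=> d0 dd0 ->; set F0 := face_of d0.
have inj: {in F0 &, injective (@next_dart G)}.
  by move=> d d' /(face_of_dart dd0) dd /(face_of_dart dd0); apply: next_dart_inj.
have E : [set next_dart d | d in F0] = F0.
  apply/eqP; rewrite eqEcard card_in_imset // leqnn andbT.
  apply/subsetP=> _ /imsetP[d' d'F ->].
  by rewrite in_face_of; apply: connect_trans (fconnect1 _ _); rewrite -in_face_of.
by rewrite -[in RHS]E big_imset.
Qed.

Lemma sum_edge F x y : adj x y ->
  \sum_(d in F) (edge d == [set x; y])%:R
  = ((x, y) \in F)%:R + ((y, x) \in F)%:R :> K.
Proof.
move=> xy; have nxy : x != y by apply: contraTneq xy => ->; rewrite adj_irr.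
have edgeE d : (edge d == [set x; y]) = (d == (x, y)) || (d == (y, x)).
  apply/eqP/orP=> [/eq_set2P|[]/eqP->] //; last by rewrite /edge setUC.
  by case: d => a b []->; [left|right].
rewrite big_mkcond /=; under eq_bigr do rewrite edgeE.
rewrite (bigD1 (x, y)) //= (bigD1 (y, x)) /=; last first.
  by rewrite xpair_eqE eq_sym negb_and nxy.
rewrite big1 => [|d /andP[/negbTE-> /negbTE->]]; last by case: ifP.
by rewrite addr0 !eqxx orbT; do 2!case: (_ \in F).
Qed.

(** Modulo 2 every entry vanishes: a closed face walk enters a vertex as often as it leaves it, and
    it contains both darts of [xw] or neither, since they lie on one face. *)
Lemma mulBA x w : adj x w -> face_of (x, w) = face_of (w, x) ->
  B *m A [set x; w] = 0.
Proof.
move=> xw sides; apply/matrixP=> i k; rewrite mxE [RHS]mxE.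
have iF := enum_valP i.
pose h (e : {set G}) : K := if split k is inl k1 then (enum_val k1 \in e)%:R
                else (e == [set x; w])%:R.
transitivity (\sum_(d in (enum_val i : {set G * G})) h (edge d)).
  rewrite -face_sum_edges // [RHS]big_enum_val; apply: eq_bigr => j _.
  by rewrite !mxE /h; case: (split k) => k1; rewrite !mxE.
rewrite /h; case: (split k) => [k1|_] /=.
  set v := enum_val k1.
  transitivity (\sum_(d in (enum_val i : {set G * G})) ((d.1 == v)%:R + (d.2 == v)%:R : K)).
    apply: eq_bigr => d dF.
    have ad : adj d.1 d.2.
      by case/facesP: iF dF => d0 dd0 -> /(face_of_dart dd0).
    rewrite in_set2 ![v == _]eq_sym.
    case: eqP => [<-|_]; last by rewrite add0r.
    by case: eqP ad => [->|_]; rewrite ?adj_irr // addr0.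
  rewrite big_split /= -(face_sum_next (fun x => (x == v)%:R)) //.
  by rewrite addrr_pchar2 // pchar_Fp.
have mem2: ((w, x) \in enum_val i) = ((x, w) \in enum_val i).
  by apply/idP/idP => /(mem_face iF)->; [rewrite -sides | rewrite sides];
    apply: face_of_refl.
by rewrite sum_edge // mem2 addrr_pchar2 // pchar_Fp.
Qed.

(** A sum of faces with zero boundary has equal coefficients on the two sides of each edge, hence,
    turning around vertices and moving along edges, everywhere. So the left kernel of [B] lies in
    the line of the all-one vector. *)
Lemma rank_faces : connected G -> (#|faces G| <= (\rank B).+1)%N.
Proof.
move=> conG; apply: (@rank_ker_le1 _ _ _ (const_mx 1)) => r rB.
pose t d := \sum_(i | enum_val i == face_of d) r 0 i.
have tE d i : enum_val i = face_of d -> t d = r 0 i.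
  move=> Ei; rewrite /t (bigD1 i) /= ?Ei // big1 ?addr0 // => j /andP[/eqP Ej].
  by rewrite -(inj_eq enum_val_inj) Ej Ei eqxx.
have t_rev x y : adj x y -> t (x, y) = t (y, x).
  move=> xy; apply: F2_eq.
  have xyE: [set x; y] \in edges G by rewrite mem_edges.
  have /matrixP/(_ 0 (enum_rank_in xyE [set x; y])) := rB.
  rewrite !mxE => <-.
  rewrite /t big_mkcond [X in _ + X]big_mkcond -big_split /=.
  apply: eq_bigr => i _; rewrite mxE enum_rankK_in //.
  have iF := enum_valP i.
  have mem d : d \in @dart G -> (d \in enum_val i) = (enum_val i == face_of d).
    move=> dd; apply/idP/eqP => [/(mem_face iF)//|->]; exact: face_of_refl.
  rewrite sum_edge // !mem //; last by rewrite unfold_in /= adj_sym.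
  by rewrite mulrDr; case: ifP; case: ifP; rewrite ?mulr0 ?mulr1.
have t_next d : d \in @dart G -> t (next_dart d) = t d.
  by move=> dd; rewrite /t face_of_next.
(* The dart after [(a, x)] is [(x, rot x a)]: crossing an edge and then stepping along the face
   turns around [x]. *)
have t_rot x y z : adj x y -> adj x z -> t (x, y) = t (x, z).
  move=> xy xz; have /iter_findex <- := rot_cyclic xy xz.
  elim: (findex _ _ _) => [|n IHn] //=.
  set a := iter _ _ _ in IHn *.
  have xa : adj x a by rewrite /a; elim: (n) => //= m; apply: rot_adj.
  rewrite IHn t_rev // -t_next //.
  by rewrite unfold_in /= adj_sym.
(* The default [x] is immaterial: [c] is evaluated through [cE] only at ends of darts. *)
pose c x := t (x, odflt x [pick y | adj x y]).
have cE x y : adj x y -> t (x, y) = c x.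
  move=> xy; rewrite /c; case: pickP => [z xz|/(_ y)]; last by rewrite xy.
  exact: t_rot.
have c_const x y : c x = c y.
  apply: connect_constant (conG x y) => a b ab.
  by rewrite -(cE _ _ ab) t_rev // cE // adj_sym.
pose x0 := (outer_dart G).1.
apply/sub_rVP; exists (c x0); apply/rowP=> i; rewrite !mxE mulr1.
have /facesP[d dd Ei] := enum_valP i.
rewrite -(tE d) // (c_const _ d.1) -(cE _ d.2) //.
by case: (d).
Qed.

(** A kernel vector of the transpose is a vertex labelling [f] with a scalar [s]: labels agree
    across every edge, except that those of [x] and [w] differ by [s]. Removing [w] or [x] leaves a
    connected graph without the edge [xw], so a third vertex [t] gives [f x = f t = f w]; hence
    [s = 0] and [f] is constant. *)
Lemma rank_edges x w : two_connected G -> adj x w ->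
  (#|G| <= \rank (A [set x; w]))%N.
Proof.
case=> card3 conG con2 xw.
suff: (#|G| + 1 <= (\rank (A [set x; w])^T).+1)%N by rewrite mxrank_tr [X in (X <= _)%N]addn1.
apply: (@rank_ker_le1 _ _ _ (row_mx (const_mx 1) 0)) => r.
rewrite -[r]hsubmxK tr_row_mx mul_row_col.
set c := lsubmx r; set s := rsubmx r.
move/matrixP => rA.
pose f v : K := c 0 (enum_rank v).
have fE a b : adj a b -> f a + f b + s 0 0 * ([set a; b] == [set x; w])%:R = 0.
  move=> ab; have abE: [set a; b] \in edges G by rewrite mem_edges.
  have := rA 0 (enum_rank_in abE [set a; b]); rewrite !mxE => <-.
  rewrite big_ord1 !mxE enum_rankK_in //; congr (_ + _).
  have nab : a != b by apply: contraTneq ab => ->; rewrite adj_irr.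
  rewrite (bigD1 (enum_rank a)) //= (bigD1 (enum_rank b)) /=; last first.
    by rewrite (inj_eq enum_rank_inj) eq_sym.
  rewrite !mxE !enum_rankK !enum_rankK_in // set21 set22 !mulr1 big1 ?addr0 //.
    by rewrite /f /c !mxE.
  move=> k /andP[ka kb]; rewrite !mxE enum_rankK_in // in_set2.
  have kE v : (enum_val k == v) = (k == enum_rank v).
    by rewrite -(inj_eq enum_rank_inj) enum_valK.
  by rewrite !kE (negbTE ka) (negbTE kb) mulr0.
have fav v : {in predC1 v &, forall y z, v \in [set x; w] -> f y = f z}.
  move=> y z yv zv vxw; apply: connect_constant (con2 v y z yv zv) => a b /= /and3P[ab av bv].
  apply: F2_eq; rewrite -[RHS](fE _ _ ab); case: eqP => [Eab|_]; last by rewrite mulr0 addr0.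
  by move: vxw; rewrite -Eab in_set2 ![v == _]eq_sym (negbTE av) (negbTE bv).
have nxw : x != w by apply: contraTneq xw => ->; rewrite adj_irr.
have /subsetPn[t _] : ~~ ([set: G] \subset [set x; w]).
  by apply: contraL card3 => /subset_leq_card; rewrite cardsT cards2 nxw -leqNgt.
rewrite in_set2 negb_or => /andP[tx tw].
have fxw : f x = f w.
  rewrite (fav w x t) ?inE ?eqxx ?orbT // (fav x w t) ?inE ?eqxx //.
  by rewrite eq_sym.
have s0 : s 0 0 = 0.
  have := fE _ _ xw; rewrite fxw eqxx mulr1 addrr_pchar2 ?pchar_Fp //.
  by rewrite add0r.
have f_const a b : f a = f b.
  apply: connect_constant (conG a b) => {}a {}b ab.
  by apply: F2_eq; rewrite -[RHS](fE _ _ ab) s0 mul0r addr0.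
apply/sub_rVP; exists (f x); rewrite scale_row_mx scaler0; congr row_mx.
  by apply/rowP=> k; rewrite !mxE mulr1 (f_const x (enum_val k)) /f enum_valK /c mxE.
by apply/rowP=> k; rewrite (ord1 k) s0 mxE.
Qed.

(* Were an edge to have the same face on both sides, adjoining its indicator
   column to the incidence matrix would keep it orthogonal to the face
   boundaries, while raising its rank; Euler's formula leaves no room for that. *)
Lemma face_sides_neq (x w : G) : plane G -> two_connected G -> adj x w ->
  face_of (x, w) <> face_of (w, x).
Proof.
move=> [conG euler] con2 xw /(mulBA xw)/mulmx0_rank_max rAB.
(* From [#|faces G| <= \rank B + 1], [#|G| <= \rank A] and [\rank B + \rank A <= #|edges G|], the
   last by [B *m A = 0], Euler's formula is violated by one. *)
have := leq_add (rank_faces conG) (rank_edges con2 xw).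
rewrite addSn addnC euler addn2 ltnS => /leq_trans/(_ rAB).
by rewrite ltnn.
Qed.

End TwoSidedEdges.

(** * Boundary segments, and the passage from twisted to perfect matchings *)

Section Segments.
Variable G : embedded_graph.
Implicit Types (P M Q : {set {set G}}) (x : G).

Definition segment_rel P : rel G := [rel a b | [set a; b] \in P].

(** The properties of a boundary segment that [untwist] uses. They pass to [sub_segment], so the
    induction on subdivisions need not follow the faces. *)
Record is_segment P : Prop := IsSegment {
  segment_edges : P \subset edges G;
  segment_degree : forall x, 1 < mdeg P x -> degree x <= 2;
  segment_connect : forall x y, 0 < mdeg P x -> 0 < mdeg P y ->
    connect (segment_rel P) x y }.

(** Only the darts [(x, y)] and [(y, x)] lie on the edge, so two distinct faces sharing it take one
    each. *)
Lemma common_edge_faces F1 F2 (x y : G) :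
    F1 \in faces G -> F2 \in faces G -> F1 != F2 ->
    [set x; y] \in face_edges F1 -> [set x; y] \in face_edges F2 ->
  (face_of (x, y) = F1 /\ face_of (y, x) = F2) \/
  (face_of (x, y) = F2 /\ face_of (y, x) = F1).
Proof.
move=> F1f F2f nF /face_edgesP[[a b] d1 /= E1] /face_edgesP[[c d] d2 /= E2].
have := mem_face F1f d1; have := mem_face F2f d2.
case: (eq_set2P E1) => -[? ?]; case: (eq_set2P E2) => -[? ?]; subst a b c d => E E'.
- by rewrite E E' eqxx in nF.
- by left.
- by right.
- by rewrite E E' eqxx in nF.
Qed.

(* At a vertex of degree 3 the three corners would force the third edge to have
   the same face on both sides. *)
Lemma common_edges_degree F1 F2 (x y z : G) : plane G -> two_connected G ->
    F1 \in faces G -> F2 \in faces G -> F1 != F2 -> y != z ->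
    adj x y -> adj x z ->
    [set x; y] \in face_edges F1 :&: face_edges F2 ->
    [set x; z] \in face_edges F1 :&: face_edges F2 ->
  degree x != 3.
Proof.
move=> pG cG F1f F2f nF nyz xy xz /setIP[y1 y2] /setIP[z1 z2].
apply/eqP=> deg3.
(* The corner at [x] from [t] to [rot x t] belongs to the face entering [x] along [(t, x)]. *)
have step t : adj x t -> face_of (x, Defs.rot x t) = face_of (t, x).
  by move=> xt; rewrite -[RHS]face_of_next // unfold_in /= adj_sym.
have /cards1P[w Nw] : #|[set t | adj x t] :\ y :\ z| == 1.
  have := cardsD1 y [set t | adj x t]; rewrite -/(degree x) deg3 inE xy => -[]; rewrite add0n => E.
  have := cardsD1 z ([set t | adj x t] :\ y); rewrite -E !inE eq_sym (negbTE nyz) xz.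
  by case; rewrite add0n => <-.
have [wz wy xw] : [/\ w != z, w != y & adj x w].
  by have := set11 w; rewrite -Nw !inE => /and3P[].
have nbr t : adj x t -> [\/ t = y, t = z | t = w].
  move=> xt; case: (altP (t =P y)) => [->|ty]; first by constructor 1.
  case: (altP (t =P z)) => [->|tz]; first by constructor 2.
  by constructor 3; apply/set1P; rewrite -Nw !inE ty tz.
have rot_neq t s : adj x t -> adj x s -> s != t -> Defs.rot x t != t.
  move=> xt xs; apply: contraNneq => fix_t.
  have /iter_findex <- := rot_cyclic xt xs.
  by elim: (findex _ _ _) => //= n /eqP->; rewrite fix_t.
have rinj := @rot_in_inj G x.
have sw : face_of (x, w) <> face_of (w, x) by apply: face_sides_neq.
have [Sy Sz] := (common_edge_faces F1f F2f nF y1 y2,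
                 common_edge_faces F1f F2f nF z1 z2).
have [[sy sz] sw'] := (step y xy, step z xz, step w xw).
have [[Ny Nz] Nw'] := (rot_neq y z xy xz, rot_neq z y xz xy, rot_neq w y xw xy).
have [[ry rz] rw] := (nbr _ (rot_adj xy), nbr _ (rot_adj xz), nbr _ (rot_adj xw)).
have iyz : Defs.rot x y <> Defs.rot x z by move/rinj => /(_ xy xz) E; rewrite E eqxx in nyz.
have iyw : Defs.rot x y <> Defs.rot x w by move/rinj => /(_ xy xw) E; rewrite E eqxx in wy.
have izw : Defs.rot x z <> Defs.rot x w by move/rinj => /(_ xz xw) E; rewrite E eqxx in wz.
have nzy : z != y by rewrite eq_sym.
have nyw : y != w by rewrite eq_sym.
(* An injective rotation of three neighbours without fixed points is one of two 3-cycles. In either,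
   the faces [F1] and [F2] alternate across [xy] and [xz], which leaves one face on both sides of
   [xw]. *)
move: Ny Nz Nw' iyz iyw izw sy sz sw'.
case: ry => ->; case: rz => ->; case: rw => ->;
  rewrite ?eqxx ?nzy ?nyz ?nyw //; try by move=> /(_ isT).
all: move=> _ _ _ _ _ _ sy sz sw'; move: Sy Sz; rewrite ?sy ?sz ?sw';
  case=> -[? ?] [] [? ?]; congruence.
Qed.

Lemma mem_edge_component (S : {set {set G}}) x e :
  (e \in edge_component S x) = (e \in S) &&
    [exists y in e, connect [rel a b | [set a; b] \in S] x y].
Proof. by rewrite inE. Qed.

(** A walk from [r] in [S] has all its edges in the component of [r], hence is a walk in that
    component. *)
Lemma edge_component_connect (S : {set {set G}}) r x :
    0 < mdeg (edge_component S r) x ->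
  connect (segment_rel (edge_component S r)) r x.
Proof.
case/card_gt0P=> y; rewrite inE mem_edge_component.
case/and3P=> _ xyS /existsP[z /andP[zxy rz]].
have reach a : connect [rel a b | [set a; b] \in S] r a ->
    connect (segment_rel (edge_component S r)) r a.
  case/connectP=> p; elim/last_ind: p a => [|p b IHp] a /=.
    by move=> _ ->; rewrite connect0.
  rewrite rcons_path last_rcons => /andP[rp bS] ->.
  apply: connect_trans (IHp _ rp erefl) _; apply: connect1; rewrite /segment_rel /=.
  rewrite mem_edge_component (bS : _ \in S); apply/existsP; exists (last r p).
  by rewrite set21; apply/connectP; exists p.
apply: connect_trans (reach _ rz) _.
move: zxy; rewrite in_set2 => /orP[]/eqP Ez; rewrite {}Ez in rz *.
  exact: connect0.
apply: connect1; rewrite /segment_rel /= mem_edge_component setUC xyS.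
by apply/existsP; exists y; rewrite set22.
Qed.

Lemma boundary_is_segment P : even_ring_system G -> boundary_segment P ->
  is_segment P.
Proof.
case=> pG _ cG deg3 deg23 [F FI]; set S := face_edges F :&: _ => -[r _ ->].
have [Fo Ff] : F != outer_face G /\ F \in faces G by move: FI; rewrite in_setD1 => /andP.
have outf : outer_face G \in faces G.
  by apply/facesP; exists (outer_dart G); rewrite ?outer_dart_dart.
have PS : edge_component S r \subset S by apply/subsetP=> e; rewrite mem_edge_component => /andP[].
split.
- apply: subset_trans PS _; apply: subset_trans (subsetIl _ _) _.
  by case/facesP: Ff => d dd ->; apply: face_edges_sub.
- move=> x /card_gt1P[y [z []]]; rewrite inE => /andP[xy yP].
  rewrite inE => /andP[xz zP] nyz.
  have [yS zS] := (subsetP PS _ yP, subsetP PS _ zP).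
  have := common_edges_degree pG cG Ff outf Fo nyz xy xz yS zS.
  have: degree x = 2 \/ degree x = 3.
    by case: (boolP (boundary_vertex x)) => [/deg23|/deg3]; auto.
  by case=> ->.
move=> x y /edge_component_connect rx /edge_component_connect ry; apply: connect_trans ry.
by rewrite sym_connect_sym // => a b; rewrite /segment_rel /= setUC.
Qed.

(* Toggling along a T-join of [D] inside the segment restores the parity. *)
Lemma untwist P (D : {set G}) : is_segment P ->
    (forall x, x \in D -> 1 < mdeg P x) -> ~~ odd #|D| ->
  exists Q, Q \subset edges G /\
    forall M, M \subset edges G ->
      twisted_matching set0 (symdiff M Q) = twisted_matching D M.
Proof.
case=> PE Pdeg Pcon DP evD; have [r rD|D0] := pickP (mem D); last first.
  exists set0; split; rewrite ?sub0set // => M ME.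
  have -> : symdiff M set0 = M by apply/setP=> e; rewrite in_symdiff in_set0 addbF.
  by congr (twisted_matching _ _); apply/setP=> x; rewrite in_set0; apply/esym/D0.
have [x|Q QP Qodd] := @exists_tjoin G P r (enum D) PE.
  by rewrite mem_enum => xD; apply: Pcon; apply: ltnW; apply: DP.
have QE := subset_trans QP PE.
exists Q; split=> // M ME; rewrite /twisted_matching symdiff_subset // ME /=.
apply: eq_forallb => x; rewrite in_set0.
(* As [D] is even, there is no parity defect at the root [r]. *)
have oddQ : odd (mdeg Q x) = (x \in D).
  by rewrite Qodd -cardE (negbTE evD) addbF count_uniq_mem ?enum_uniq // mem_enum; case: (_ \in _).
(* At degree at most 2, being covered once is the same as being covered an odd number of times. *)
have deg2 N : degree x <= 2 -> (mdeg N x == 1) = odd (mdeg N x).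
  by move/(leq_trans (mdeg_le_degree N x)); case: (mdeg N x) => [|[|[]]].
case: ifP oddQ => xD oddQ.
  rewrite deg2; last by apply: Pdeg; apply: DP.
  by rewrite odd_mdeg_symdiff oddQ addbT.
(* Outside [D] the degree of [Q] is even. If it is 0, nothing changes at [x]; otherwise [x] has
   degree at most 2 and parity decides. *)
have [Q0|Qx] := posnP (mdeg Q x).
  congr (_ == 1); apply: eq_card => y; rewrite in_set [in RHS]in_set in_symdiff.
  have: y \notin [set y | adj x y & [set x; y] \in Q].
    by move/eqP: Q0; rewrite /mdeg cards_eq0 => /eqP->; rewrite in_set0.
  by rewrite inE; case: adj => //= /negbTE->; rewrite addbF.
have Qx2 : 1 < mdeg Q x by case: (mdeg Q x) Qx oddQ => [|[]].
have dx : degree x <= 2 by apply: Pdeg; apply: leq_trans Qx2 (leq_mdeg _ QP).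
by rewrite !deg2 // odd_mdeg_symdiff oddQ addbF.
Qed.

End Segments.

(** * Equivalence of twisted matchings and its transfer along a map of edges *)

Section ResonanceEquivalence.

Definition face_flip (G : embedded_graph) (M1 M2 : {set {set G}}) :=
  [exists F in inner_faces G, symdiff M1 M2 == face_edges F].

(** A relaxed isomorphism of resonance graphs: the maps act on all edge sets and are mutually
    inverse only on twisted matchings, so equivalences compose without subtypes. *)
Definition resonance_equiv (G H : embedded_graph) (D : {set G}) (D' : {set H}) :=
  exists (phi : {set {set G}} -> {set {set H}})
         (psi : {set {set H}} -> {set {set G}}),
  [/\ forall M, twisted_matching D M ->
        twisted_matching D' (phi M) /\ psi (phi M) = M,
      forall N, twisted_matching D' N ->
        twisted_matching D (psi N) /\ phi (psi N) = N &
      forall M1 M2, twisted_matching D M1 -> twisted_matching D M2 ->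
        face_flip (phi M1) (phi M2) = face_flip M1 M2].

Lemma resonance_equiv_trans (G H K : embedded_graph)
    (D : {set G}) (D' : {set H}) (D'' : {set K}) :
  resonance_equiv D D' -> resonance_equiv D' D'' -> resonance_equiv D D''.
Proof.
move=> [f [f' [fT f'T fF]]] [g [g' [gT g'T gF]]].
exists (g \o f), (f' \o g'); split=> /=.
- by move=> M /fT[/gT[gfM ->] ->].
- by move=> N /g'T[/f'T[fgN ->] ->].
- by move=> M1 M2 M1T M2T; rewrite gF ?fF //; [case: (fT _ M1T)|case: (fT _ M2T)].
Qed.

Lemma resonance_equiv_isomorphic (G H : embedded_graph) :
    resonance_equiv (set0 : {set G}) (set0 : {set H}) ->
  isomorphic (resonance_graph G) (resonance_graph H).
Proof.
move=> [f [f' [fT f'T fF]]].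
have pmT (K : embedded_graph) (M : pmatching K) : twisted_matching set0 (val M).
  by rewrite -perfect_matchingE (valP M).
have fP (M : pmatching G) : perfect_matching (f (val M)).
  by rewrite perfect_matchingE; case: (fT _ (pmT _ M)).
have f'P (M : pmatching H) : perfect_matching (f' (val M)).
  by rewrite perfect_matchingE; case: (f'T _ (pmT _ M)).
exists (fun M : pmatching G => Sub (f (val M)) (fP M) : pmatching H); last first.
  by move=> M1 M2; apply: fF; apply: pmT.
exists (fun M : pmatching H => Sub (f' (val M)) (f'P M) : pmatching G) => M;
  apply: val_inj => /=.
  by case: (fT _ (pmT _ M)).
by case: (f'T _ (pmT _ M)).
Qed.

Section Transfer.
Variables (G H : embedded_graph) (pi : {set H} -> {set G}).
Implicit Types M : {set {set G}}.

(** Here [pi] sends an edge of [H] to the edge of [G] on which it lies; a subdivided edge is pulled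
    back to all of its pieces. *)
Definition pull (M : {set {set G}}) : {set {set H}} :=
  [set e in edges H | pi e \in M].

Lemma mem_pull M e : (e \in pull M) = (e \in edges H) && (pi e \in M).
Proof. by rewrite inE. Qed.

Lemma pull_symdiff M1 M2 : pull (symdiff M1 M2) = symdiff (pull M1) (pull M2).
Proof.
apply/setP=> e; rewrite in_symdiff !mem_pull in_symdiff.
by case: (e \in edges H).
Qed.

Hypothesis pi_edges : {in edges H, forall e, pi e \in edges G}.
Hypothesis pi_onto :
  {in edges G, forall e, exists2 e', e' \in edges H & pi e' = e}.

Lemma pull_imset M : M \subset edges G -> pi @: pull M = M.
Proof.
move/subsetP=> ME; apply/setP=> e; apply/imsetP/idP => [[e']|eM].
  by rewrite inE => /andP[_ eM] ->.
have [e' e'H E] := pi_onto (ME _ eM).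
by exists e'; rewrite // inE e'H E.
Qed.

Lemma pull_inj M1 M2 :
  M1 \subset edges G -> M2 \subset edges G -> pull M1 = pull M2 -> M1 = M2.
Proof. by move=> M1E M2E E; rewrite -[M1]pull_imset // E pull_imset. Qed.

(* [g] sends the darts of [G] to darts of [H] bounding corresponding faces. *)
Lemma transfer_equiv (g : G * G -> H * H) (D : {set G}) (D' : {set H}) :
    (forall M, M \subset edges G ->
      twisted_matching D' (pull M) = twisted_matching D M) ->
    (forall N, twisted_matching D' N ->
      {in edges H &, forall e1 e2, pi e1 = pi e2 -> (e1 \in N) = (e2 \in N)}) ->
    {in @dart G, forall d, g d \in @dart H} ->
    {in @dart G &, forall d d', (g d' \in face_of (g d)) = (d' \in face_of d)} ->
    {in @dart H, forall d', exists2 d, d \in @dart G & d' \in face_of (g d)} ->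
    g (outer_dart G) \in outer_face H ->
    {in @dart G, forall d,
      face_edges (face_of (g d)) = pull (face_edges (face_of d))} ->
  resonance_equiv D D'.
Proof.
move=> twist sat g_dart g_face g_onto g_outer g_edges.
(* By [sat], [N] is a union of fibres of [pi], hence recoverable from its image. *)
have imsetK N : twisted_matching D' N -> pull (pi @: N) = N.
  move=> NT; have /andP[/subsetP NE _] := NT.
  apply/setP=> e; rewrite inE; apply/andP/idP => [[eH]|eN]; last first.
    by rewrite NE ?imset_f.
  by case/imsetP=> e' e'N /(sat _ NT) -> //; apply: NE.
have imset_sub N : twisted_matching D' N -> pi @: N \subset edges G.
  case/andP=> /subsetP NE _; apply/subsetP=> _ /imsetP[e /NE eH ->].
  exact: pi_edges.
exists pull, (fun N : {set {set H}} => pi @: N); split.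
- by move=> M MT; have /andP[ME _] := MT; rewrite twist // pull_imset.
- by move=> N NT; rewrite -twist ?imset_sub // imsetK.
move=> M1 M2 /andP[M1E _] /andP[M2E _]; rewrite /face_flip -pull_symdiff.
(* The outer faces correspond under [g], so inner faces correspond to inner faces. *)
have out d : d \in @dart G ->
    (face_of (g d) == outer_face H) = (face_of d == outer_face G).
  move=> dd; have od := outer_dart_dart G.
  have gout := face_of_eq (outer_dart_dart H) g_outer.
  apply/eqP/eqP => E.
    apply/esym/face_of_eq => //; rewrite -g_face // E; exact: g_outer.
  rewrite -[RHS]gout; apply/esym/face_of_eq; first exact: g_dart.
  by rewrite g_face // E face_of_refl.
apply/existsP/existsP => -[F /andP[]]; rewrite in_setD1 => /andP[Fo /facesP[d dd EF]].
  have [d0 dd0 d0d] := g_onto _ dd.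
  move: Fo; rewrite EF (face_of_eq (g_dart _ dd0) d0d) out // => Fo /eqP.
  rewrite g_edges // => /pull_inj E; exists (face_of d0).
  rewrite in_setD1 Fo E ?eqxx ?andbT ?symdiff_subset ?face_edges_sub //.
  by apply/facesP; exists d0.
move/eqP=> ->; exists (face_of (g d)).
rewrite in_setD1 out // -EF Fo g_edges // -EF eqxx andbT.
by apply/facesP; exists (g d); rewrite ?g_dart.
Qed.

End Transfer.

End ResonanceEquivalence.

(** * Invariance under plane isomorphism *)

Lemma fconnect_ind (T : finType) (f : T -> T) x y : fconnect f x y ->
  forall Q : T -> Prop, Q x -> (forall z, Q z -> Q (f z)) -> Q y.
Proof.
move=> /iter_findex <- Q Qx Qf.
by elim: (findex _ _ _) => [|n IHn] //=; apply: Qf.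
Qed.

Section PlaneIsomorphism.
Variables (G H : embedded_graph) (f : G -> H).
Hypothesis f_bij : bijective f.
Hypothesis f_adj : forall x y : G, adj (f x) (f y) = adj x y.

Let f_inj : injective f := bij_inj f_bij.

Lemma f_onto (x : H) : exists y, x = f y.
Proof. by have [f' _ fK] := f_bij; exists (f' x); rewrite fK. Qed.

Definition edge_preim (e : {set H}) : {set G} := f @^-1: e.

Lemma preim_edge x y : edge_preim [set f x; f y] = [set x; y].
Proof. by apply/setP=> z; rewrite !inE !(inj_eq f_inj). Qed.

Lemma preim_edges : {in edges H, forall e, edge_preim e \in edges G}.
Proof.
move=> e /edgesP[x [y []]].
have [[x' ->] [y' ->]] := (f_onto x, f_onto y).
by rewrite f_adj => xy ->; rewrite preim_edge mem_edges.
Qed.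

Lemma preim_edges_onto :
  {in edges G, forall e, exists2 e', e' \in edges H & edge_preim e' = e}.
Proof.
move=> e /edgesP[x [y [xy ->]]]; exists [set f x; f y].
  by rewrite mem_edges f_adj.
exact: preim_edge.
Qed.

Lemma mdeg_preim M x : mdeg (pull edge_preim M) (f x) = mdeg M x.
Proof.
rewrite /mdeg -[RHS](card_imset _ f_inj); apply: eq_card => z.
have [y ->] := f_onto z; rewrite mem_imset // !inE mem_edges f_adj preim_edge.
by case: adj.
Qed.

(** Common core of the two orientations, which differ only in the dart map [g]. *)
Lemma preim_equiv (g : G * G -> H * H) :
    {in @dart G, forall d, [set (g d).1; (g d).2] = f @: [set d.1; d.2]} ->
    {in @dart G, forall d d',
      (d' \in face_of (g d)) <-> (exists2 d1, d1 \in face_of d & d' = g d1)} ->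
    injective g ->
    {in @dart H, forall d', exists2 d, d \in @dart G & d' = g d} ->
    g (outer_dart G) \in outer_face H ->
  resonance_equiv (set0 : {set G}) (set0 : {set H}).
Proof.
move=> g_edge g_face g_inj g_onto g_outer.
have g_dart d : d \in @dart G -> g d \in @dart H.
  move=> dd; rewrite unfold_in /= -mem_edges g_edge //.
  by rewrite imsetU1 imset_set1 mem_edges f_adj.
apply: (transfer_equiv preim_edges preim_edges_onto (g := g)) => //.
- move=> M ME; rewrite /twisted_matching ME.
  have -> : pull edge_preim M \subset edges H.
    by apply/subsetP=> e; rewrite inE => /andP[].
  apply/forallP/forallP => /= h x; last have [y ->] := f_onto x.
    by have := h (f x); rewrite !in_set0 mdeg_preim.
  by have := h y; rewrite !in_set0 mdeg_preim.
- move=> N _ e1 e2 _ _ E; suff -> : e1 = e2 by []; apply/setP=> x.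
  by have [y ->] := f_onto x; have /setP/(_ y) := E; rewrite !inE.
- move=> d d' dd dd'; apply/idP/idP => [/(g_face _ dd)[d1 d1d /g_inj->] //|d'd].
  by apply/(g_face _ dd); exists d'.
- move=> d' /g_onto[d dd ->]; exists d => //; exact: face_of_refl.
move=> d dd; apply/setP=> e; rewrite inE.
apply/face_edgesP/andP => [[d' /(g_face _ dd)[d1 d1d ->] ->]|].
  have dd1 := face_of_dart dd d1d.
  rewrite mem_edges; split; first exact: g_dart.
  by apply/face_edgesP; exists d1; rewrite // g_edge // imsetU1 imset_set1 preim_edge.
case=> _ /face_edgesP[d1 d1d E]; have dd1 := face_of_dart dd d1d.
exists (g d1); first by apply/(g_face _ dd); exists d1.
rewrite g_edge // -E; apply/setP=> x; have [y ->] := f_onto x.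
by rewrite mem_imset // inE.
Qed.

End PlaneIsomorphism.

Lemma plane_isomorphic_equiv (G H : embedded_graph) :
  plane_isomorphic G H -> resonance_equiv (set0 : {set G}) (set0 : {set H}).
Proof.
case=> f [f_bij f_adj or]; have f_inj := bij_inj f_bij.
have sym_dart x y : (x, y) \in @dart G -> (y, x) \in @dart G.
  by rewrite !unfold_in /= adj_sym.
case: or => -[f_rot f_outer].
  (* Orientation preserved: [g] commutes with [next_dart]. *)
  pose g d : H * H := (f d.1, f d.2).
  have g_next d : d \in @dart G -> next_dart (g d) = g (next_dart d).
    by move=> dd; rewrite /next_dart /g /= f_rot // adj_sym.
  apply: (preim_equiv f_bij f_adj (g := g)) => //.
  - by move=> d _; rewrite imsetU1 imset_set1.
  - move=> d dd d'; rewrite in_face_of; split=> [|[d1]].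
      move=> gd; pattern d'; apply: (fconnect_ind gd); first by exists d; rewrite ?face_of_refl.
      move=> _ [d1 d1d ->]; exists (next_dart d1).
        by rewrite -(face_of_eq dd d1d) in_face_of fconnect1.
      by rewrite g_next // (face_of_dart dd d1d).
    rewrite in_face_of => d1d ->.
    suff [] : d1 \in @dart G /\ fconnect (@next_dart H) (g d) (g d1) by [].
    pattern d1; apply: (fconnect_ind d1d); first by rewrite connect0.
    move=> y [dy gy]; split; first exact: next_dart_dart.
    by rewrite -g_next //; apply: connect_trans gy (fconnect1 _ _).
  - by move=> [a b] [c d] [/f_inj-> /f_inj->].
  - move=> [a b]; have [[a' ->] [b' ->]] := (f_onto f_bij a, f_onto f_bij b).
    by rewrite unfold_in /= f_adj => ab; exists (a', b').
(* Orientation reversed: [g] also reverses darts and carries [next_dart] to its inverse. *)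
pose g d : H * H := (f d.2, f d.1).
have g_next d : d \in @dart G -> next_dart (g (next_dart d)) = g d.
  by move=> dd; rewrite /next_dart /g /= f_rot // adj_sym.
have g_dart d : d \in @dart G -> g d \in @dart H.
  by rewrite !unfold_in /= f_adj adj_sym.
apply: (preim_equiv f_bij f_adj (g := g)) => //.
- by move=> d _; rewrite imsetU1 imset_set1 setUC.
- move=> d dd d'; rewrite in_face_of; split=> [|[d1]].
    move=> gd; pattern d'; apply: (fconnect_ind gd); first by exists d; rewrite ?face_of_refl.
    move=> _ [d1 d1d ->]; have dd1 := face_of_dart dd d1d.
    have: fconnect (@next_dart G) (next_dart d1) d1.
      rewrite face_connect_sym ?fconnect1 //; exact: next_dart_dart.
    (* The dart [d2] is the predecessor of [d1] on its face. *)
    move/iter_findex; rewrite -iterSr iterS; set d2 := iter _ _ _ => E.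
    have d2d1: d2 \in face_of d1 by rewrite in_face_of fconnect_iter.
    exists d2; first by rewrite -(face_of_eq dd d1d).
    by rewrite -E g_next // (face_of_dart dd1 d2d1).
  rewrite in_face_of => d1d ->.
  suff [] : d1 \in @dart G /\ fconnect (@next_dart H) (g d) (g d1) by [].
  pattern d1; apply: (fconnect_ind d1d); first by rewrite connect0.
  move=> y [dy gy]; have dy' := next_dart_dart dy; split=> //.
  apply: connect_trans gy _; rewrite face_connect_sym ?g_dart //.
  by rewrite -[X in fconnect _ _ X](g_next y) // fconnect1.
- by move=> [a b] [c d] [/f_inj-> /f_inj->].
- move=> [a b]; have [[a' ->] [b' ->]] := (f_onto f_bij a, f_onto f_bij b).
  by rewrite unfold_in /= f_adj => ab; exists (b', a') => //; apply: sym_dart.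
Qed.

(** * Subdivision of one edge *)

Section SubdivisionStep.
Variables (G : embedded_graph) (u v : G) (uv : adj u v).
Notation S := (subdivide uv).
Implicit Types (x y : G) (M : {set {set G}}).

Definition unsub_edge (e : {set S}) : {set G} :=
  if None \in e then [set u; v] else [set x | Some x \in e].

Definition sub_dart (d : G * G) : S * S := (Some d.1, sub_head u v d.1 d.2).

Lemma unsub_head x y : unsub_edge [set (Some x : S); sub_head u v x y] = [set x; y].
Proof.
rewrite /unsub_edge /sub_head; case: eqP => [->|_]; rewrite in_set2 ?eqxx //=.
by apply/setP=> z; rewrite !inE.
Qed.

Lemma unsub_None (a : S) : unsub_edge [set None; a] = [set u; v].
Proof. by rewrite /unsub_edge set21. Qed.

(** The new vertex [None] is adjacent only to old vertices, so each edge can be written from an old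
    end. *)
Lemma sub_edgesP (e : {set S}) : reflect
  (exists x y, adj x y /\ e = [set (Some x : S); sub_head u v x y]) (e \in edges S).
Proof.
apply: (iffP (edgesP _)) => [[a [b [ab ->]]]|[x [y [xy ->]]]]; last first.
  by exists (Some x), (sub_head u v x y); split=> //; apply: (sub_head_adj uv).
case: a ab => [x|]; first by case/(sub_adj_head uv) => y xy ->; exists x, y.
case: b => [x|//] ab; have := ab; rewrite adj_sym => /(sub_adj_head uv)[y xy E].
by exists x, y; split; rewrite // setUC -E.
Qed.

Lemma unsub_edges : {in edges S, forall e, unsub_edge e \in edges G}.
Proof. by move=> _ /sub_edgesP[x [y [xy ->]]]; rewrite unsub_head mem_edges. Qed.

Lemma unsub_edges_onto :
  {in edges G, forall e, exists2 e', e' \in edges S & unsub_edge e' = e}.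
Proof.
move=> _ /edgesP[x [y [xy ->]]]; exists [set (Some x : S); sub_head u v x y].
  by apply/sub_edgesP; exists x, y.
exact: unsub_head.
Qed.

Lemma sub_head_inj x : injective (sub_head u v x).
Proof. exact: can_inj (sub_headK uv x). Qed.

Lemma mdeg_pull_Some M x : mdeg (pull unsub_edge M) (Some x : S) = mdeg M x.
Proof.
rewrite /mdeg -[RHS](card_imset _ (@sub_head_inj x)); apply: eq_card => a.
apply/idP/imsetP => [|[y]]; rewrite inE => /andP[].
  case/(sub_adj_head uv)=> y xy ->; rewrite mem_pull unsub_head => /andP[_ xyM].
  by exists y; rewrite // inE xy.
move=> xy xyM ->; rewrite inE mem_pull unsub_head xyM andbT mem_edges andbb.
exact: (sub_head_adj uv).
Qed.

Lemma adj_None (a : S) : adj (None : S) a = (a \in [set Some u; Some v]).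
Proof. by case: a => [x|]; rewrite /= !inE. Qed.

Lemma mdeg_None (N : {set {set S}}) : odd (mdeg N None)
  = ([set None; Some u] \in N) (+) ([set None; Some v] \in N).
Proof.
rewrite odd_mdeg (eq_bigl _ _ adj_None) big_setU1 ?big_set1 //= in_set1.
by rewrite (inj_eq Some_inj) (sub_neq uv).
Qed.

Lemma pull_pieces M (a : S) : adj (None : S) a ->
  ([set (None : S); a] \in pull unsub_edge M) = ([set u; v] \in M).
Proof. by move=> Na; rewrite mem_pull mem_edges Na unsub_None. Qed.

(** Degrees at old vertices agree, and a pulled back set contains both halves of the cut edge or
    neither, so its degree at [None] is even. *)
Lemma sub_twisted (D : {set G}) M : M \subset edges G ->
  twisted_matching (None |: (@Some G) @: D : {set S}) (pull unsub_edge M)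
  = twisted_matching D M.
Proof.
move=> ME; rewrite /twisted_matching ME.
have -> : pull unsub_edge M \subset edges S.
  by apply/subsetP=> e; rewrite mem_pull => /andP[].
have memD x : (Some x \in None |: (@Some G) @: D) = (x \in D).
  by rewrite in_setU1 /= mem_imset //; apply: Some_inj.
apply/forallP/forallP => /= h.
  by move=> x; have := h (Some x); rewrite memD mdeg_pull_Some.
case=> [x|]; first by rewrite memD mdeg_pull_Some.
rewrite in_setU1 eqxx mdeg_None !pull_pieces ?addbb //.
  by rewrite adj_None set22.
by rewrite adj_None set21.
Qed.

(** Evenness at [None] forces both halves of the cut edge into [N], or neither; this is why the new
    vertex joins the twist. *)
Lemma sub_saturated (D' : {set S}) N : None \in D' -> twisted_matching D' N ->
  {in edges S &, forall e1 e2,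
    unsub_edge e1 = unsub_edge e2 -> (e1 \in N) = (e2 \in N)}.
Proof.
move=> ND /andP[_ /forallP/(_ None)]; rewrite ND mdeg_None => parity.
have pieces : ([set None; Some u] \in N) = ([set None; Some v] \in N).
  by move: parity; do 2!case: (_ \in N).
move=> _ _ /sub_edgesP[x [y [xy ->]]] /sub_edgesP[x2 [y2 [_ ->]]].
rewrite !unsub_head => /eq_set2P[][-> ->] //.
(* Written from its two ends, an uncut edge gives the same set twice, the cut edge its two
   halves. *)
rewrite /sub_head [[set x2; y2]]setUC.
case: (sub_edgeP uv) => [[[-> ->]|[-> ->]]|_]; last by rewrite setUC.
  by rewrite ![[set Some _; None]]setUC.
by rewrite ![[set Some _; None]]setUC.
Qed.

Lemma sub_dart_dart d : d \in @dart G -> sub_dart d \in @dart S.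
Proof. exact: (sub_head_adj uv). Qed.

Lemma sub_dart_inj : injective sub_dart.
Proof. by move=> [a b] [c d] [-> /sub_head_inj->]. Qed.

Lemma sub_next d : [set d.1; d.2] != [set u; v] ->
  next_dart (sub_dart d) = sub_dart (next_dart d).
Proof.
by move=> dE; rewrite /next_dart /sub_dart /= /sub_head (negbTE dE).
Qed.

Lemma sub_next_cut d : [set d.1; d.2] = [set u; v] ->
  next_dart (sub_dart d) = (None, Some d.2).
Proof.
case: d => x y /= dE; rewrite /next_dart /sub_dart /= /sub_head dE eqxx /=.
have /eqP/(sub_edgeP uv)[[-> ->]|[-> ->]] := dE; first by rewrite eqxx.
by rewrite (inj_eq Some_inj) eq_sym (negbTE (sub_neq uv)).
Qed.

(** A face walk through the new vertex makes one extra step and then rejoins the image of the old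
    walk. *)
Lemma sub_next2_cut d : [set d.1; d.2] = [set u; v] ->
  next_dart (next_dart (sub_dart d)) = sub_dart (next_dart d).
Proof.
move=> dE; rewrite sub_next_cut //; case: d dE => x y /= /eqP dE.
rewrite /next_dart /sub_dart /=; case/(sub_edgeP uv): dE => -[-> ->].
  by rewrite eq_sym (negbTE (sub_neq uv)).
by rewrite eqxx.
Qed.

(** The successor of [sub_dart d1] is the image of the next dart or the second half of the cut edge,
    so these two forms exhaust the orbit. *)
Lemma face_of_sub_dart d d' : d \in @dart G ->
  (d' \in face_of (sub_dart d)) <->
  (exists2 d1, d1 \in face_of d &
     d' = sub_dart d1 \/ d' = next_dart (sub_dart d1)).
Proof.
move=> dd; rewrite in_face_of; split=> [h|[d1]].
  pattern d'; apply: (fconnect_ind h); first by exists d; rewrite ?face_of_refl; auto.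
  move=> _ [d1 d1d [->|->]]; first by exists d1; auto.
  have nd1 : next_dart d1 \in face_of d.
    by rewrite -(face_of_eq dd d1d) in_face_of fconnect1.
  have [dE|dE] := altP ([set d1.1; d1.2] =P [set u; v]).
    by exists (next_dart d1); rewrite // sub_next2_cut; auto.
  by exists (next_dart d1); rewrite // sub_next; auto.
rewrite in_face_of => d1d.
suff h : fconnect (@next_dart S) (sub_dart d) (sub_dart d1).
  by case=> ->; rewrite // (connect_trans h) ?fconnect1.
pattern d1; apply: (fconnect_ind d1d); first exact: connect0.
move=> y /connect_trans; apply.
have [dE|dE] := altP ([set y.1; y.2] =P [set u; v]); last first.
  by rewrite -sub_next // fconnect1.
by rewrite -sub_next2_cut // (connect_trans (fconnect1 _ _)) // fconnect1.
Qed.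

Lemma mem_face_sub_dart d d' : d \in @dart G ->
  (sub_dart d' \in face_of (sub_dart d)) = (d' \in face_of d).
Proof.
move=> dd; apply/idP/idP => [/(face_of_sub_dart _ dd)|d'd]; last first.
  by apply/(face_of_sub_dart _ dd); exists d'; auto.
case=> d1 d1d [/sub_dart_inj->//|].
have [dE|dE] := altP ([set d1.1; d1.2] =P [set u; v]).
  by rewrite sub_next_cut.
rewrite sub_next // => /sub_dart_inj->.
by rewrite -(face_of_eq dd d1d) in_face_of fconnect1.
Qed.

Lemma sub_dart_onto (d' : S * S) : d' \in @dart S ->
  exists2 d, d \in @dart G & d' \in face_of (sub_dart d).
Proof.
case: d' => -[x|] b; rewrite unfold_in /=.
  by case/(sub_adj_head uv)=> y xy ->; exists (x, y); last exact: (face_of_refl (sub_dart (x, y))).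
case: b => // y /=; rewrite in_set2 => /orP[]/eqP->.
  exists (v, u); first by rewrite unfold_in /= adj_sym.
  apply/face_of_sub_dart; first by rewrite unfold_in /= adj_sym.
  exists (v, u); first exact: face_of_refl.
  by right; rewrite sub_next_cut // setUC.
exists (u, v); first by [].
apply/face_of_sub_dart; first by [].
by exists (u, v); [exact: face_of_refl | right; rewrite sub_next_cut].
Qed.

Lemma face_edges_sub_dart d : d \in @dart G ->
  face_edges (face_of (sub_dart d)) = pull unsub_edge (face_edges (face_of d)).
Proof.
move=> dd; have gd := sub_dart_dart dd; apply/setP=> e; rewrite mem_pull.
apply/idP/andP => [eF|[]].
  split; first by apply: subsetP eF; apply: face_edges_sub.
  case/face_edgesP: eF => d' /(face_of_sub_dart _ dd)[d1 d1d Ed'] ->.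
  have d1F : [set d1.1; d1.2] \in face_edges (face_of d).
    by apply/face_edgesP; exists d1.
  case: Ed' => ->; first by rewrite unsub_head.
  have [dE|dE] := altP ([set d1.1; d1.2] =P [set u; v]).
    by rewrite sub_next_cut //= unsub_None -dE.
  rewrite sub_next // unsub_head; apply/face_edgesP; exists (next_dart d1) => //.
  by rewrite -(face_of_eq dd d1d) in_face_of fconnect1.
case/sub_edgesP=> x [y [xy ->]]; rewrite unsub_head.
case/face_edgesP=> -[a b] d1d E; rewrite /= in E; apply/face_edgesP.
case/eq_set2P: E d1d => -[<- <-] d1d.
  exists (sub_dart (x, y)) => //; apply/(face_of_sub_dart _ dd).
  by exists (x, y); auto.
have [dE|dE] := altP ([set y; x] =P [set u; v]); last first.
  exists (sub_dart (y, x)); last by rewrite /= /sub_head [[set x; y]]setUC (negbTE dE) setUC.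
  by apply/(face_of_sub_dart _ dd); exists (y, x); auto.
(* The face traverses the cut edge from [y], so the half at [x] is the second one met. *)
exists (next_dart (sub_dart (y, x))).
  by apply/(face_of_sub_dart _ dd); exists (y, x); auto.
by rewrite sub_next_cut //= /sub_head [[set x; y]]setUC dE eqxx setUC.
Qed.

Lemma subdivide_equiv (D : {set G}) :
  resonance_equiv D (None |: (@Some G) @: D : {set S}).
Proof.
apply: (transfer_equiv unsub_edges unsub_edges_onto (g := sub_dart)).
- exact: sub_twisted.
- by move=> N; apply: sub_saturated; rewrite setU11.
- exact: sub_dart_dart.
- by move=> d d' dd _; apply: mem_face_sub_dart.
- exact: sub_dart_onto.
- exact: face_of_refl.
- exact: face_edges_sub_dart.
Qed.

Lemma sub_segmentE (P : {set {set G}}) : P \subset edges G -> [set u; v] \in P ->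
  sub_segment uv P = pull unsub_edge P.
Proof.
move=> /subsetP PE uvP; apply/setP=> e; rewrite mem_pull.
have Nu : adj (None : S) (Some u) by rewrite adj_None set21.
have Nv : adj (None : S) (Some v) by rewrite adj_None set22.
rewrite in_setU; apply/orP/andP => [[/imsetP[e0]|]|[]].
- rewrite in_setD1 => /andP[ne eP] ->; have := PE _ eP.
  case/edgesP=> x [y [xy E]]; rewrite E in ne eP *.
  have -> : Some @: [set x; y] = [set (Some x : S); sub_head u v x y].
    by rewrite imsetU1 imset_set1 /sub_head (negbTE ne).
  by rewrite unsub_head; split=> //; apply/sub_edgesP; exists x, y.
- rewrite in_set2 => /orP[]/eqP->; last by rewrite unsub_None mem_edges.
  by rewrite setUC unsub_None mem_edges.
case/sub_edgesP=> x [y [xy ->]]; rewrite unsub_head => xyP.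
rewrite /sub_head; have [/eqP|ne] := altP ([set x; y] =P [set u; v]); last first.
  left; apply/imsetP; exists [set x; y]; first by rewrite in_setD1 ne.
  by rewrite imsetU1 imset_set1.
case/(sub_edgeP uv)=> -[-> _]; right; rewrite in_set2 ?eqxx //.
by rewrite [[set Some v; None]]setUC eqxx orbT.
Qed.

Lemma sub_segment_None (P : {set {set G}}) : [set u; v] \in P ->
  1 < mdeg (pull unsub_edge P) (None : S).
Proof.
move=> uvP; apply/card_gt1P.
have h (a : S) : a \in [set Some u; Some v] ->
    a \in [set y | adj (None : S) y & [set (None : S); y] \in pull unsub_edge P].
  by rewrite -adj_None => Na; rewrite inE pull_pieces // Na uvP.
exists (Some u), (Some v); split; last by rewrite (inj_eq Some_inj) (sub_neq uv).
  by apply: h; rewrite set21.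
by apply: h; rewrite set22.
Qed.

Lemma sub_is_segment (P : {set {set G}}) : [set u; v] \in P ->
  is_segment P -> is_segment (sub_segment uv P).
Proof.
move=> uvP [PE Pdeg Pcon]; rewrite sub_segmentE //.
have PSE : pull unsub_edge P \subset edges S.
  by apply/subsetP=> e; rewrite mem_pull => /andP[].
have edgesE : pull unsub_edge (edges G) = edges S.
  by apply/setP=> e; rewrite mem_pull andb_idr // => /unsub_edges.
split=> //.
- case=> [x|_]; last first.
    rewrite /degree (_ : [set y | _] = [set Some u; Some v]).
      by rewrite cards2; case: eqP.
    by apply/setP=> a; rewrite inE adj_None.
  rewrite mdeg_pull_Some => /Pdeg.
  by rewrite !degree_mdeg -edgesE mdeg_pull_Some.
set c := connect _.
have c_sym : symmetric c.
  by apply: sym_connect_sym => a b; rewrite /segment_rel /= setUC.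
(* The cut edge is replaced by the path through [None]. *)
have c_edge x y : [set x; y] \in P -> c (Some x) (Some y).
  move=> xyP; have xy : adj x y by rewrite -mem_edges (subsetP PE).
  have h a b : adj a b -> [set a; b] \in P ->
      [set (Some a : S); sub_head u v a b] \in pull unsub_edge P.
    by move=> ab abP; rewrite mem_pull unsub_head abP andbT; apply/sub_edgesP; exists a, b.
  have := h x y xy xyP; have := h y x; rewrite adj_sym setUC => /(_ xy xyP).
  rewrite /sub_head [[set y; x]]setUC; case: eqP => _ hy hx; last exact: connect1.
  apply: (@connect_trans _ _ None); apply: connect1 => //.
  by rewrite /segment_rel /= setUC.
have c_Some x y : connect (segment_rel P) x y -> c (Some x) (Some y).
  by apply: connect_homo => a b; apply: c_edge.
(* Every vertex on the new segment is linked to an old one, [None] to [u]. *)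
have base a : 0 < mdeg (pull unsub_edge P) a ->
    exists2 x, 0 < mdeg P x & c a (Some x).
  case: a => [x|_]; first by rewrite mdeg_pull_Some => h; exists x; rewrite // /c connect0.
  exists u; first exact: mdeg_gt0 uv uvP.
  apply: connect1; rewrite /segment_rel /= pull_pieces // adj_None set21 //.
move=> a b /base[x xP ax] /base[y yP bY].
apply: connect_trans ax _; rewrite c_sym in bY; apply: connect_trans bY.
exact/c_Some/Pcon.
Qed.

End SubdivisionStep.

(** * Iterated subdivisions and the conclusion *)

(** The twist [D] is arbitrary so that the induction goes through: each subdivision lowers [n] by
    one and adds the new vertex to [D], keeping [n + #|D|] even. At [n = 0] the set [D] is even and
    [untwist] removes it. *)
Lemma subdivided_equiv (G H : embedded_graph) (P : {set {set G}}) n :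
    subdivided P n H ->
  forall D : {set G}, is_segment P -> (forall x, x \in D -> 1 < mdeg P x) ->
    ~~ odd (n + #|D|) -> resonance_equiv D (set0 : {set H}).
Proof.
elim=> {G P n H} [G P H GH | G P n H u v uv uvP _ IH] D segP DP evD.
  apply: resonance_equiv_trans (plane_isomorphic_equiv GH).
  have [Q [QE Qtwist]] := untwist segP DP evD.
  exists (fun M => symdiff M Q), (fun M => symdiff M Q); split.
  - by move=> M MT; rewrite Qtwist ?symdiffK //; case/andP: MT.
  - move=> M MT; have ME : M \subset edges G by case/andP: MT.
    by rewrite -Qtwist ?symdiff_subset // symdiffK.
  - by move=> M1 M2 _ _; rewrite /face_flip symdiff_cancel.
apply: resonance_equiv_trans (subdivide_equiv uv D) (IH _ _ _ _).
- exact: sub_is_segment.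
- rewrite sub_segmentE // ?segment_edges // => a; rewrite in_setU1.
  case/orP=> [/eqP->|/imsetP[x xD ->]]; first exact: sub_segment_None.
  by rewrite mdeg_pull_Some DP.
rewrite cardsU1 card_imset; last exact: Some_inj.
rewrite (_ : None \notin _) ?addnA ?addn1 //.
by apply/imsetP=> -[].
Qed.

Lemma segment_subdivision_isomorphic (G H : embedded_graph) :
    even_ring_system G -> segment_subdivision G H ->
  isomorphic (resonance_graph G) (resonance_graph H).
Proof.
move=> ersG [P [n [bP evn GH]]]; apply: resonance_equiv_isomorphic.
apply: (subdivided_equiv GH (D := set0)); first exact: boundary_is_segment.
  by move=> x; rewrite in_set0.
by rewrite cards0 addn0.
Qed.

Lemma isomorphic_refl (G : sgraph) : isomorphic G G.
Proof. by exists id => //; exists id. Qed.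

Lemma isomorphic_sym (G H : sgraph) : isomorphic G H -> isomorphic H G.
Proof.
case=> f [g fK gK] f_adj; exists g; first by exists f.
by move=> x y; rewrite -f_adj !gK.
Qed.

Lemma isomorphic_trans (G H K : sgraph) :
  isomorphic G H -> isomorphic H K -> isomorphic G K.
Proof.
case=> f f_bij f_adj [g g_bij g_adj]; exists (g \o f); first exact: bij_comp.
by move=> x y; rewrite /= g_adj f_adj.
Qed.

Theorem theorem4p4 (G H : embedded_graph) (cersG : cers G) (cersH : cers H) :
  resonantly_equivalent G H ->
  isomorphic (resonance_graph G) (resonance_graph H).
Proof.
(* By definition [resonantly_equivalent G H] is a chain from [H] to [G], so the goal is turned
   around before the induction; each link brings the [cers] hypotheses of its two ends. *)
move=> GH; apply: isomorphic_sym; elim: GH {cersG cersH} => {G H}.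
- move=> G H [[ersG _] [ersH _] [GH|HG]].
    exact: segment_subdivision_isomorphic.
  exact/isomorphic_sym/segment_subdivision_isomorphic.
- by move=> G; apply: isomorphic_refl.
- by move=> G H K _ GH _ HK; apply: isomorphic_trans GH HK.
Qed.
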